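(* If $p\in(1,2)$ and $q\in(2,\infty)$, or $p\in(2,\infty)$ and $q\in(1,2)$, then the range of every contractive projection on the real Banach space $\ell_p(\ell_q)$ has a block basis.
   Context: All Banach spaces are over $\mathbb{R}$. $\ell_p(\ell_q)$ is the Banach space of all functions $x\colon\mathbb{N}\to\ell_q$ with $\|x\|=\big(\sum_{k=1}^\infty\|x(k)\|_q^p\big)^{1/p}<\infty$. Elements $x,y\in\ell_p(\ell_q)$ are disjoint if for every $k\in\mathbb{N}$ the sequences $x(k),y(k)\in\ell_q$ have disjoint supports (with respect to the standard unit vector basis of $\ell_q$). A block basis of a subspace $Y$ is a (Schauder) basis $\{y_i\}_{i=1}^{\dim Y}$ of $Y$ such that $y_i$ and $y_j$ are disjoint for all $i\neq j$. A contractive projection on a Banach space $Z$ is a linear map $P\colon Z\to Z$ with $P^2=P$ and $\|P\|\le1$. *)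

(* Defs.v *)
From HB Require Import structures.
From mathcomp Require Import all_boot all_order all_algebra.
From mathcomp Require Import all_classical all_reals all_analysis.

Set Implicit Arguments.
Unset Strict Implicit.
Unset Printing Implicit Defensive.
Import Order.TTheory GRing.Theory Num.Theory.
Import numFieldNormedType.Exports.

Local Open Scope classical_set_scope.
Local Open Scope ring_scope.

Section lp_norm.
Context (R : realType) (E : normedModType R) (p : R).
Implicit Types x y : nat -> E.

Definition lp_enorm x : \bar R := Lnorm counting p%:E (fun k => `|x k|%:E).

Definition lp_pred : {pred nat -> E} := [pred x | (lp_enorm x < +oo)%E].

Lemma lp_enormE x : 0 < p ->
  lp_enorm x = ((\sum_(0 <= k <oo) (`|x k| `^ p)%:E) `^ p^-1)%E.
Proof.
move=> p0; rewrite /lp_enorm Lnorm_counting//; congr (_ `^ _)%E.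
by apply: eq_eseriesr => k _; rewrite gee0_abs// lee_fin.
Qed.

Lemma lp_enorm0 : 0 < p -> lp_enorm 0 = 0%E.
Proof.
move=> p0; rewrite lp_enormE// eseries0 ?poweR0r ?invr_eq0 ?gt_eqF//.
by move=> k _ _; rewrite normr0 powR0// gt_eqF.
Qed.

Lemma lp_enormZ (a : R) x : 0 < p ->
  lp_enorm (a *: x) = (`|a|%:E * lp_enorm x)%E.
Proof.
move=> p0; rewrite !lp_enormE//.
under eq_eseriesr do rewrite normrZ powRM// EFinM.
rewrite nneseriesZl; last by move=> k _; rewrite lee_fin powR_ge0.
rewrite poweRM ?lee_fin ?powR_ge0//; last first.
  by apply: nneseries_ge0 => k _ _; rewrite lee_fin powR_ge0.
by rewrite poweR_EFin -powRrM mulfV ?gt_eqF// powRr1.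
Qed.

Lemma ler_lp_enormD x y : 1 <= p ->
  (lp_enorm (x + y)%R <= lp_enorm x + lp_enorm y)%E.
Proof.
move=> p1; have p0 : 0 < p := lt_le_trans ltr01 p1.
have := @eminkowski _ nat R counting (fun k => `|x k|) (fun k => `|y k|) p%:E.
move=> /(_ _ _ _)/(le_trans _); apply => //.
rewrite lp_enormE// Lnorm_counting//.
have ge0 k : (0 <= (`|(x + y) k| `^ p)%:E)%E by rewrite lee_fin powR_ge0.
apply: gt0_ler_poweR.
- by rewrite invr_ge0 ltW.
- by rewrite in_itv/= leey andbT; apply: nneseries_ge0.
- by rewrite in_itv/= leey andbT; apply: nneseries_ge0 => k _ _; rewrite lee_fin powR_ge0.
apply: lee_nneseries => // k _.
rewrite gee0_abs ?lee_fin ?addr_ge0//=.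
apply: ge0_ler_powR; rewrite ?nnegrE ?(ltW p0) ?addr_ge0 ?normr_ge0 ?ler_normD//.
Qed.

Lemma lp_enorm_eq0 x : 0 < p -> lp_enorm x = 0%E -> x = 0.
Proof.
move=> p0; rewrite lp_enormE// => /poweR_eq0_eq0.
have ge0 i : (0 <= (`|x i| `^ p)%:E)%E by rewrite lee_fin powR_ge0.
move=> /(_ (nneseries_ge0 (fun i _ _ => ge0 i))) s0.
apply/funext => k.
have : ((`|x k| `^ p)%:E <= 0)%E.
  rewrite -s0; apply: le_trans (nneseries_lim_ge k.+1 (fun i _ _ => ge0 i)).
  by rewrite big_nat_recr//= leeDr// sume_ge0.
by rewrite lee_fin le_eqVlt ltNge powR_ge0 orbF powR_eq0 normr_eq0 => /andP[/eqP].
Qed.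

Lemma lp_submod_closed : 1 <= p -> submod_closed lp_pred.
Proof.
move=> p1; have p0 : 0 < p := lt_le_trans ltr01 p1.
split=> [|a x y]; rewrite !inE; first by rewrite lp_enorm0// ltry.
move=> xp yp; apply: le_lt_trans (ler_lp_enormD _ _ p1) _.
by rewrite lp_enormZ// lte_add_pinfty// lte_mul_pinfty// lee_fin.
Qed.

End lp_norm.

(* The space l_p(E) of p-summable E-valued sequences; the parameter [p1] only
   serves to find its normed space structure. *)
Record lp (R : realType) (E : normedModType R) (p : R) (p1 : 1 <= p) : Type :=
  Lp { lp_seq :> nat -> E ; lp_seqP : lp_seq \in lp_pred p }.
Arguments lp {R} E {p} p1.

Section lp_type.
Context (R : realType) (E : normedModType R) (p : R) (p1 : 1 <= p).
Local Notation lp := (lp E p1).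

HB.instance Definition _ := [isSub of lp for @lp_seq R E p p1].
HB.instance Definition _ := [Choice of lp by <:].

Let p0 : 0 < p. Proof. exact: lt_le_trans ltr01 p1. Qed.

HB.instance Definition _ :=
  GRing.SubChoice_isSubLmodule.Build R _ (@lp_pred R E p) lp
    (GRing.submod_closed_semi (lp_submod_closed E p1)).

Definition lp_norm (x : lp) : R := fine (lp_enorm p x).

Lemma lp_normE (x : lp) : (lp_norm x)%:E = lp_enorm p x.
Proof.
rewrite fineK// ge0_fin_numE ?Lnorm_ge0//; exact: (lp_seqP x).
Qed.

Let ler_lp_normD (x y : lp) : lp_norm (x + y) <= lp_norm x + lp_norm y.
Proof. by rewrite -lee_fin EFinD !lp_normE; exact: ler_lp_enormD. Qed.

Let lp_normZ (a : R) (x : lp) : lp_norm (a *: x) = `|a| * lp_norm x.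
Proof. by apply: EFin_inj; rewrite EFinM !lp_normE; exact: lp_enormZ. Qed.

Let lp_norm_eq0 (x : lp) : lp_norm x = 0 -> x = 0.
Proof.
move=> x0; apply: val_inj; apply: (@lp_enorm_eq0 _ _ p _ p0).
by rewrite -lp_normE x0.
Qed.

HB.instance Definition _ :=
  @Lmodule_isNormed.Build R lp lp_norm ler_lp_normD lp_normZ lp_norm_eq0.

Lemma lp_norm_def (x : lp) :
  `|x|%:E = ((\sum_(0 <= k <oo) (`|x k| `^ p)%:E) `^ p^-1)%E.
Proof. by rewrite -lp_enormE//; exact: lp_normE. Qed.

Lemma ler_lp_coord (x : lp) k : `|x k| <= `|x|.
Proof.
have ge0 i : (0 <= (`|x i| `^ p)%:E)%E by rewrite lee_fin powR_ge0.
rewrite -lee_fin lp_norm_def -[X in (X <= _)%E](_ : (`|x k| `^ p)%:E `^ p^-1 = _)%E.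
  apply: gt0_ler_poweR.
  - by rewrite invr_ge0 ltW.
  - by rewrite in_itv/= leey andbT.
  - by rewrite in_itv/= leey andbT; apply: nneseries_ge0.
  apply: le_trans (nneseries_lim_ge k.+1 (fun i _ _ => ge0 i)).
  by rewrite big_nat_recr//= leeDr// sume_ge0.
by rewrite poweR_EFin -powRrM mulfV ?gt_eqF// powRr1.
Qed.

End lp_type.

Lemma cvg_norm_powR (R : realType) (T : Type) (F : set_system T) (f : T -> R)
    (a p : R) : Filter F -> 0 < p -> (forall t, 0 <= f t) ->
  f @ F --> a -> (fun t => f t `^ p) @ F --> a `^ p.
Proof.
move=> FF p0 f0 fa; have [a0|a0|a0] := ltgtP a 0.
- have /cvgrPdist_lt/(_ (- a)) := fa; rewrite oppr_gt0 => /(_ a0) Fa.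
  have F0 : F set0.
    apply: filterS Fa => t /=; rewrite ltr0_norm.
      by rewrite opprB ltrBlDr addNr ltNge f0.
    by rewrite subr_lt0 (lt_le_trans a0).
  by move=> A _; exact: (@filterS _ F FF _ _ (@sub0set _ _) F0).
- have : {for a, continuous (fun t : R => t `^ p)}.
    apply/differentiable_continuous/derivable1_diffP.
    by apply: derivable_powR; rewrite in_itv/= andbT.
  exact: cvg_comp.
rewrite a0 powR0 ?gt_eqF//; apply/cvgr0Pnorm_le => e e0.
move: fa; rewrite a0 => /cvgr0Pnorm_le/(_ (e `^ p^-1)).
rewrite powR_gt0// => /(_ erefl); apply: filterS => t /=.
rewrite !ger0_norm ?powR_ge0// => fte.
rewrite -[leRHS]powRr1 ?(ltW e0)// -(@mulVf _ p) ?gt_eqF// powRrM.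
by apply: ge0_ler_powR => //; rewrite ?nnegrE ?powR_ge0// ltW.
Qed.

Section lp_complete.
Context (R : realType) (E : completeNormedModType R) (p : R) (p1 : 1 <= p).

Let p0 : 0 < p. Proof. exact: lt_le_trans ltr01 p1. Qed.

Let lp_cauchy_cvg (F : set_system (lp E p1)) :
  ProperFilter F -> cauchy F -> cvg F.
Proof.
move=> FF Fc.
have coord k : cvg ((fun x : lp E p1 => x k) @ F).
  apply: cauchy_cvg; apply: cauchy_exP => e e0.
  have [x Fx] := (cauchyP F).1 Fc e e0.
  exists (x k); apply: (@filterS _ F _ (ball x e)) Fx => y.
  rewrite /= -!ball_normE/= => xy.
  by apply: le_lt_trans xy; exact: (ler_lp_coord (x - y)).
pose l k := lim ((fun x : lp E p1 => x k) @ F).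
have xl e (x : lp E p1) : 0 < e -> F (ball x e) ->
    (lp_enorm p (lp_seq x - l)%R <= e%:E)%E.
  move=> e0 Fx.
  have ge0 k : (0 <= (`|(lp_seq x - l) k| `^ p)%:E)%E by rewrite lee_fin powR_ge0.
  have bnd n : \sum_(0 <= k < n) `|(lp_seq x - l) k| `^ p <= e `^ p.
    have cv : (fun y : lp E p1 => \sum_(0 <= k < n) `|x k - y k| `^ p) @ F -->
        \sum_(0 <= k < n) `|x k - l k| `^ p.
      apply: cvg_big => [|k _]; first exact: add_continuous.
      apply: cvg_norm_powR => //; apply: cvg_norm; apply: cvgB => //.
      exact: cvg_cst.
    apply: cvgr_to_le cv _; apply: filterS Fx => y.
    rewrite -ball_normE/= => /ltW xy.
    have := lp_norm_def (x - y).
    set S := (\sum_(0 <= k <oo) _)%E => SE.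
    have S0 : (0 <= S)%E by apply: nneseries_ge0 => k _ _; rewrite lee_fin powR_ge0.
    have {}SE : S = (`|x - y| `^ p)%:E.
      by rewrite -poweR_EFin SE -poweRrM mulVf ?gt_eqF// poweRe1.
    rewrite -lee_fin -sumEFin; apply: (@le_trans _ _ S).
      by apply: nneseries_lim_ge => k _ _; rewrite lee_fin powR_ge0.
    by rewrite SE lee_fin ge0_ler_powR ?nnegrE ?(ltW p0) ?(ltW e0).
  rewrite lp_enormE// -[e%:E]poweRe1 ?lee_fin ?(ltW e0)// -(@mulfV _ p) ?gt_eqF//.
  rewrite poweRrM; apply: gt0_ler_poweR.
  - by rewrite invr_ge0 ltW.
  - by rewrite in_itv/= leey andbT; apply: nneseries_ge0.
  - by rewrite in_itv/= leey andbT lee_fin powR_ge0.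
  apply: lime_le; first by apply: is_cvg_nneseries.
  by apply: nearW => n; rewrite sumEFin lee_fin.
have lP : l \in lp_pred p.
  have [x Fx] := (cauchyP F).1 Fc 1 ltr01.
  rewrite -[l](subKr (lp_seq x)) inE.
  apply: le_lt_trans (ler_lp_enormD _ _ p1) _.
  rewrite -[X in (_ + lp_enorm _ X)%E]scaleN1r lp_enormZ// normrN1 mul1e.
  rewrite lte_add_pinfty//; first exact: (lp_seqP x).
  by apply: le_lt_trans (xl _ _ ltr01 Fx) _; rewrite ltry.
apply/cvg_ex; exists (Lp p1 lP); apply/cvgrPdist_le => e e0.
have e2 : 0 < e / 2 by rewrite divr_gt0.
have [x Fx] := (cauchyP F).1 Fc _ e2.
apply: filterS (Fx) => y; rewrite -ball_normE/= => /ltW xy.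
rewrite -[_ - y](subrKA x) (splitr e) (le_trans (ler_normD _ _))// lerD//.
by rewrite distrC -lee_fin [X in (X <= _)%E]lp_normE; exact: xl.
Qed.

HB.instance Definition _ := Uniform_isComplete.Build (lp E p1) lp_cauchy_cvg.

End lp_complete.

Section contractive_projection.
Context (R : realType) (Z : normedModType R).

Definition op_norm (P : {linear Z -> Z}) : \bar R :=
  ereal_sup [set `|P x|%:E | x in [set x | `|x| <= 1]].

Definition contractive_projection (P : {linear Z -> Z}) : Prop :=
  (forall x, P (P x) = P x) /\ (op_norm P <= 1)%E.

End contractive_projection.

Section bases.
Context (R : realType) (Z : normedModType R) (Y : set Z).

Definition finite_basis n (y : 'I_n -> Z) : Prop :=
  (forall i, Y (y i)) /\
  forall v, Y v -> exists! a : 'I_n -> R, v = \sum_i a i *: y i.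

Definition schauder_basis (y : nat -> Z) : Prop :=
  (forall i, Y (y i)) /\
  forall v, Y v -> exists! a : nat -> R, series (fun i => a i *: y i) @ \oo --> v.

End bases.

Section block_basis.
Context (R : realType) (p q : R) (p1 : 1 <= p) (q1 : 1 <= q).
Local Notation lplq := (lp (lp R q1) p1).

Definition disjoint_elts (x y : lplq) : Prop :=
  forall k, [set j | x k j != 0] `&` [set j | y k j != 0] = set0.

(* The two cases are those of a finite (possibly zero) and of an infinite
   dimension of [Y]: the size of the basis determines the dimension. *)
Definition has_block_basis (Y : set lplq) : Prop :=
  (exists n, exists y : 'I_n -> lplq,
     finite_basis Y y /\ forall i j, i != j -> disjoint_elts (y i) (y j)) \/
  (exists y : nat -> lplq,
     schauder_basis Y y /\ forall i j, i != j -> disjoint_elts (y i) (y j)).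

End block_basis.

(* Main.v *)
(** Let [y] be in the range of [P], let [e_a] be the unit vector at the entry [a], and
    write [D(z, t)] for the second difference
    [|y + t z|^p + |y - t z|^p - 2 |y|^p].  Since [P y = y] and [P] is contractive,
    [D(P e_a, t) <= D(e_a, t)].  As [t] tends to [0], [D(e_a, t)] is of order [t^p], [t^q]
    or [t^2] according as [y] vanishes on the row of [a], vanishes at [a] only, or does
    not vanish at [a]; and [D(z, t)] is at least of the order attached to [b] whenever
    [z] does not vanish at [b].  So [P e_a] lives on entries of order at least that of
    [a].  Moreover, if [P] preserves the elements living on a set of entries, it also
    preserves those living off this set, by smoothness and strict monotonicity of the
    norm.  As [2] lies strictly between [p] and [q], these two facts together show that
    [P] preserves the elements vanishing on the support of [y].  Taking for [y] the
    vectors [P e_a] and their combinations, any two of the [P e_a] are disjoint or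
    parallel, and one nonzero vector from each class gives the block basis. *)

Require Import Defs.
From mathcomp Require Import all_boot all_order all_algebra.
From mathcomp Require Import all_classical all_reals all_analysis.
From mathcomp Require Import ring lra.
Import Order.TTheory GRing.Theory Num.Theory.
Import numFieldNormedType.Exports.
Local Open Scope classical_set_scope.
Local Open Scope ring_scope.

(** * Powers of real numbers near a point *)

Section real_powers.
Context {R : realType}.
Implicit Types (a b c d e p q s u v C N : R).

Lemma powR_ge1Dln v s : 0 < v -> 1 + s * ln v <= v `^ s.
Proof.
by move=> v0; rewrite /powR gt_eqF// expR_ge1Dx.
Qed.

Lemma ln_leB1 v : 0 < v -> ln v <= v - 1.
Proof.
by move=> v0; have := expR_ge1Dx (ln v); rewrite lnK ?posrE//; lra.
Qed.

Lemma ln_ge1BV v : 0 < v -> 1 - v^-1 <= ln v.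
Proof.
by move=> v0; have := @ln_leB1 v^-1; rewrite invr_gt0 lnV ?posrE// => /(_ v0); lra.
Qed.

(** Write [v^s] as [v] times the square of [v^((s-1)/2)]; the tangent bound [1 + w] of the latter is
    nonnegative in this range of [v], so it can be squared. *)
Lemma powR_ge_quad s v : 1 < s -> `|v - 1| <= (2 * s)^-1 ->
  (s - 1) ^+ 2 / 8 * (v - 1) ^+ 2 <= v `^ s - 1 - s * (v - 1).
Proof.
move=> s1 vs; have s0 : 0 < s by lra.
have e2 : (2 * s)^-1 <= 2^-1 by rewrite lef_pV2 ?posrE//; lra.
have /andP[vl vu] : 2^-1 <= v <= 3 / 2 by move: vs; rewrite ler_norml; lra.
have v0 : 0 < v by lra.
set i := v^-1; have iv : v * i = 1 by rewrite mulfV ?gt_eqF.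
have i0 : 0 < i by rewrite invr_gt0.
set t := s - 1; set w := t / 2 * (1 - i).
have w1 : 0 <= 1 + w.
  have -> : 1 + w = 1 + t / 2 * ((v - 1) * i) by rewrite /w (mulrBl i v) iv mul1r.
  have : - (v - 1) * s * 2 <= 1.
    rewrite mulrAC -mulrA -ler_pdivlMr ?mulr_gt0// div1r.
    by move: vs; rewrite ler_norml mulrC; lra.
  have i2 : i <= 2 by rewrite -[2]invrK lef_pV2 ?posrE// invr_gt0.
  have := @mulr_ge0 _ i (v - 2^-1) (ltW i0); rewrite subr_ge0 => /(_ vl).
  rewrite /t; nra.
have le1 : (1 + w) ^+ 2 <= v `^ t.
  have -> : v `^ t = (v `^ (t / 2)) ^+ 2.
    by rewrite -powR_mulrn ?powR_ge0// -powRrM divfK.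
  rewrite ler_pXn2r ?nnegrE ?powR_ge0//.
  apply: le_trans (powR_ge1Dln _ _ v0); rewrite lerD2l ler_wpM2l//.
    by rewrite /t; lra.
  exact: ln_ge1BV.
have : v * (1 + w) ^+ 2 <= v `^ s by rewrite -(@mulr_powRB1 _ v s) ?(ltW v0)// ler_pM2l.
have -> : v * (1 + w) ^+ 2 = v + t * (v - 1) + t ^+ 2 / 4 * ((v - 1) ^+ 2 * i).
  rewrite /w; have -> : v - 1 = v - v * i by rewrite iv.
  have e : v * i * i = i by rewrite iv mul1r.
  transitivity (v + t * (v - v * i) + t^+2 / 4 * (v - 2 * (v * i) + v * i * i)).
    by field.
  rewrite e iv.
  have -> : (v - 1) ^+ 2 * i = v * (v * i) - 2 * (v * i) + i by ring.
  by rewrite iv; ring.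
have i23 : 2 / 3 <= i by rewrite -[2 / 3]invf_div lef_pV2 ?posrE//.
move=> H; rewrite -subr_ge0.
have : 0 <= t ^+ 2 / 4 * ((v - 1) ^+ 2 * (i - 2^-1)).
  by apply: mulr_ge0; [rewrite divr_ge0 ?sqr_ge0|apply: mulr_ge0; [exact: sqr_ge0|lra]].
move: H; rewrite /t; set X := (v - 1) ^+ 2; set S := (s - 1) ^+ 2.
by rewrite mulrBr mulrBr; lra.
Qed.

(** The tangent bound for [v^(-s)] is [1 - x]; as [|x| <= 1/2], inverting it costs only a quadratic
    term. *)
Lemma powR_le_quad s v : 1 < s -> `|v - 1| <= (2 * s)^-1 ->
  v `^ s - 1 - s * (v - 1) <= 2 * s ^+ 2 * (v - 1) ^+ 2.
Proof.
move=> s1 vs; have s0 : 0 < s by lra.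
have e2 : (2 * s)^-1 <= 2^-1 by rewrite lef_pV2 ?posrE//; lra.
have v0 : 0 < v by move: vs; rewrite ler_norml; lra.
set x := s * (v - 1).
have x2 : `|x| <= 2^-1.
  by rewrite normrM gtr0_norm// (le_trans (ler_wpM2l (ltW s0) vs))//
    invfM mulrCA divff ?mulr1// gt_eqF.
have /andP[xl xu] : - 2^-1 <= x <= 2^-1 by rewrite -ler_norml.
have : 1 - x <= v `^ (- s).
  apply: le_trans (powR_ge1Dln _ _ v0).
  by rewrite lerD2l /x mulNr lerN2 ler_pM2l// ln_leB1.
rewrite powRN; set V := v `^ s; have V0 : 0 < V by exact: powR_gt0.
rewrite -(ler_pM2r V0) mulVf ?gt_eqF// => H.
have -> : 2 * s ^+ 2 * (v - 1) ^+ 2 = 2 * x ^+ 2 by rewrite /x; ring.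
suff : V <= 1 + x + 2 * x ^+ 2 by lra.
have : 1 <= (1 - x) * (1 + x + 2 * x ^+ 2).
  have -> : (1 - x) * (1 + x + 2 * x ^+ 2) = 1 + x ^+ 2 * (1 - 2 * x) by ring.
  by rewrite lerDl mulr_ge0 ?sqr_ge0//; lra.
move/(le_trans H); rewrite ler_pM2l//; lra.
Qed.

Definition powR_gap p N a b := a `^ p + b `^ p - 2 * N `^ p.

(** After division by [N^r], the gap of exponent [r] is [r] times the nonnegative excess
    [(x-1) + (y-1)] plus a term between two positive multiples of [(x-1)^2 + (y-1)^2]. The constant
    [m] compares both parts at once. *)
Lemma powR_gap_comparable p q N : 1 < p -> 1 < q -> 0 < N ->
  exists2 k, 0 < k & exists2 d, 0 < d & forall a b, `|a - N| <= d -> `|b - N| <= d ->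
    2 * N <= a + b -> k * powR_gap q N a b <= powR_gap p N a b.
Proof.
move=> p1 q1 N0.
pose cp := (p - 1) ^+ 2 / 8; pose Cq := 2 * q ^+ 2.
have cp0 : 0 < cp by rewrite divr_gt0// exprn_gt0//; lra.
have Cq0 : 0 < Cq by rewrite mulr_gt0// exprn_gt0//; lra.
have p0 : 0 < p by lra.
have q0 : 0 < q by lra.
pose m := Num.min (p / q) (cp / Cq).
have m0 : 0 < m by rewrite lt_min; apply/andP; split; exact: divr_gt0.
have mp : m * q <= p by rewrite -ler_pdivlMr// ge_min lexx.
have mc : m * Cq <= cp by rewrite -ler_pdivlMr// ge_min lexx orbT.
exists (N `^ p / N `^ q * m); first by rewrite mulr_gt0// divr_gt0// powR_gt0.
pose d := N * Num.min (2 * p)^-1 (2 * q)^-1.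
exists d; first by rewrite mulr_gt0// lt_min !invr_gt0 !mulr_gt0.
move=> a b aN bN ab.
have nm c : `|c - N| <= d -> [/\ 0 <= c / N, `|c / N - 1| <= (2 * p)^-1 &
    `|c / N - 1| <= (2 * q)^-1].
  move=> cN.
  have cN' : `|c / N - 1| <= Num.min (2 * p)^-1 (2 * q)^-1.
    have -> : c / N - 1 = (c - N) / N by field; rewrite gt_eqF.
    by rewrite normrM normfV (gtr0_norm N0) ler_pdivrMr// mulrC.
  move: (cN'); rewrite le_min => /andP[cp' cq']; split=> //.
  have e2 : (2 * p)^-1 <= 2^-1 by rewrite lef_pV2 ?posrE//; lra.
  by move: cp'; rewrite ler_norml; lra.
have [x0 xp xq] := nm _ aN; have [y0 yp yq] := nm _ bN.
set x := a / N in x0 xp xq; set y := b / N in y0 yp yq.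
have L0 : 0 <= (x - 1) + (y - 1).
  rewrite /x /y; have -> : a / N - 1 + (b / N - 1) = (a + b - 2 * N) / N.
    by field; rewrite gt_eqF.
  by rewrite divr_ge0 ?(ltW N0)// subr_ge0.
have gapE r : powR_gap r N a b = N `^ r * (x `^ r + y `^ r - 2).
  have -> : a = x * N by rewrite divfK ?gt_eqF.
  have -> : b = y * N by rewrite divfK ?gt_eqF.
  by rewrite /powR_gap (powRM r x0 (ltW N0)) (powRM r y0 (ltW N0)); ring.
rewrite !gapE.
have -> : N `^ p / N `^ q * m * (N `^ q * (x `^ q + y `^ q - 2)) =
   N `^ p * (m * (x `^ q + y `^ q - 2)).
  by field; rewrite gt_eqF// powR_gt0.
rewrite ler_pM2l ?powR_gt0//.
have h1 := powR_ge_quad _ _ p1 xp; have h2 := powR_ge_quad _ _ p1 yp.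
have h3 := powR_le_quad _ _ q1 xq; have h4 := powR_le_quad _ _ q1 yq.
rewrite -/cp in h1 h2; rewrite -/Cq in h3 h4.
set X := (x - 1) ^+ 2 in h1 h3; set Y := (y - 1) ^+ 2 in h2 h4.
have X0 : 0 <= X by exact: sqr_ge0.
have Y0 : 0 <= Y by exact: sqr_ge0.
apply: (@le_trans _ _ (m * (q * (x - 1 + (y - 1)) + Cq * (X + Y)))).
  by rewrite ler_pM2l//; lra.
apply: (@le_trans _ _ (p * (x - 1 + (y - 1)) + cp * (X + Y))); last by lra.
have XY0 : 0 <= X + Y by exact: addr_ge0.
by rewrite mulrDr; apply: lerD; rewrite mulrA ler_wpM2r.
Qed.

Lemma small_powR c C d e : 0 < c -> 0 < d -> 0 < e ->
  exists2 t, 0 < t <= d & C * t `^ e < c.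
Proof.
move=> c0 d0 e0; pose D := `|C| + 1; have D0 : 0 < D by rewrite ltr_wpDl.
pose t := Num.min d ((c / D) `^ e^-1).
have t0 : 0 < t by rewrite lt_min d0 powR_gt0// divr_gt0.
exists t; first by rewrite t0 ge_min lexx.
have te : t `^ e <= c / D.
  have -> : c / D = ((c / D) `^ e^-1) `^ e.
    by rewrite -powRrM mulVf ?gt_eqF// powRr1// divr_ge0// ltW.
  apply: ge0_ler_powR; rewrite ?nnegrE ?powR_ge0 ?(ltW t0) ?(ltW e0)//.
  by rewrite ge_min lexx orbT.
have te0 : 0 < t `^ e by rewrite powR_gt0.
apply: (@lt_le_trans _ _ (D * t `^ e)).
  by rewrite ltr_pM2r// (le_lt_trans (ler_norm _))// /D ltrDl.
by rewrite mulrC -ler_pdivlMr.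
Qed.

Lemma powR_exponent_le c C d u v : 0 < c -> 0 < d ->
  (forall t, 0 < t <= d -> c * t `^ u <= C * t `^ v) -> v <= u.
Proof.
move=> c0 d0 H; rewrite leNgt; apply/negP => uv.
have [|t td] := @small_powR c C d (v - u) c0 d0; first by rewrite subr_gt0.
have t0 : 0 < t by case/andP: td.
apply/negP; rewrite -leNgt -(@ler_pM2r _ (t `^ u)) ?powR_gt0//.
by rewrite -mulrA -powRD ?(gt_eqF t0) ?implybT// subrK H.
Qed.

End real_powers.

(** * Norms and coordinates in [l_p(E)] *)

Section lp_space.
Context {R : realType} {E : normedModType R} {p : R} {p1 : 1 <= p}.
Local Notation lp := (lp E p1).
Implicit Types (x y : lp) (f : nat -> E) (k l : nat) (A : pred nat).

Let p0 : 0 < p. Proof. exact: lt_le_trans ltr01 p1. Qed.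

Lemma lp_ext x y : (forall k, x k = y k) -> x = y.
Proof. by move=> xy; apply/val_inj/funext. Qed.

Lemma lp_addE x y k : (x + y) k = x k + y k. Proof. by []. Qed.
Lemma lp_oppE x k : (- x) k = - x k. Proof. by []. Qed.
Lemma lp_scaleE (a : R) x k : (a *: x) k = a *: x k. Proof. by []. Qed.
Lemma lp_sumE (I : Type) (r : seq I) (F : I -> lp) k :
  (\sum_(i <- r) F i) k = \sum_(i <- r) F i k.
Proof. by elim/big_rec2: _ => // i a b _ <-. Qed.

Lemma lp_norm_powR x :
  ((`|x| `^ p)%:E = \sum_(0 <= k <oo) (`|x k| `^ p)%:E)%E.
Proof.
rewrite -poweR_EFin lp_norm_def -poweRrM mulVf ?gt_eqF// poweRe1//.
by apply: nneseries_ge0 => k _ _; rewrite lee_fin powR_ge0.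
Qed.

Lemma lp_dominated x f : (forall k, `|f k| <= `|x k|) -> f \in lp_pred p.
Proof.
move=> fx; rewrite inE; apply: le_lt_trans (lp_seqP x).
rewrite /= !lp_enormE//; apply: gt0_ler_poweR.
- by rewrite invr_ge0 ltW.
- by rewrite in_itv/= leey andbT; apply: nneseries_ge0 => k _ _; rewrite lee_fin powR_ge0.
- by rewrite in_itv/= leey andbT; apply: nneseries_ge0 => k _ _; rewrite lee_fin powR_ge0.
apply: lee_nneseries => k _; rewrite lee_fin ?powR_ge0//.
by rewrite ge0_ler_powR ?nnegrE ?(ltW p0).
Qed.

Lemma ler_lp_norm x y : (forall k, `|x k| <= `|y k|) -> `|x| <= `|y|.
Proof.
move=> xy.
have : `|x| `^ p <= `|y| `^ p.
  rewrite -lee_fin !lp_norm_powR; apply: lee_nneseries => k _; rewrite lee_fin ?powR_ge0//.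
  by rewrite ge0_ler_powR ?nnegrE ?(ltW p0).
by apply: contraTT; rewrite -!ltNge => yx; rewrite gt0_ltr_powR ?nnegrE.
Qed.

Lemma eq_lp_norm x y : (forall k, `|x k| = `|y k|) -> `|x| = `|y|.
Proof. by move=> xy; apply: le_anti; rewrite !ler_lp_norm// => k; rewrite xy. Qed.

Lemma lp_restr_subproof A x : (fun k => if A k then x k else 0) \in lp_pred p.
Proof. by apply: (lp_dominated x) => k; case: ifP; rewrite ?normr0. Qed.

Definition lp_restr A x : lp := Lp p1 (lp_restr_subproof A x).

Lemma lp_norm_restrC A x :
  `|x| `^ p = `|lp_restr A x| `^ p + `|lp_restr (predC A) x| `^ p.
Proof.
apply: EFin_inj; rewrite EFinD !lp_norm_powR -nneseriesD; last 2 first.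
- by move=> k _ _; rewrite lee_fin powR_ge0.
- by move=> k _ _; rewrite lee_fin powR_ge0.
apply: eq_eseriesr => k _ /=; rewrite -EFinD; case: (A k) => /=.
  by rewrite normr0 powR0 ?gt_eqF// addr0.
by rewrite normr0 powR0 ?gt_eqF// add0r.
Qed.

Lemma lp_single_subproof l (v : E) : (fun k => if k == l then v else 0) \in lp_pred p.
Proof.
rewrite inE/= lp_enormE// (@nneseries_split _ _ 0 l.+1); last first.
  by move=> k _; rewrite lee_fin powR_ge0.
rewrite eseries0 ?adde0; last first.
  by move=> k lk _; rewrite (gtn_eqF lk) normr0 powR0 ?gt_eqF.
by rewrite sumEFin poweR_EFin ltry.
Qed.

Definition lp_single l v : lp := Lp p1 (lp_single_subproof l v).

Lemma lp_singleE l v : lp_single l v l = v. Proof. by rewrite /= eqxx. Qed.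

Lemma lp_norm_single l v : `|lp_single l v| = `|v|.
Proof.
have : `|lp_single l v| `^ p = `|v| `^ p.
  apply: EFin_inj; rewrite lp_norm_powR (@nneseriesD1 _ _ l xpredT)//.
  rewrite lp_singleE eseries0 ?adde0// => k _ /=.
  by move=> /negbTE ->; rewrite normr0 powR0 ?gt_eqF.
by apply: powR_injective; rewrite ?nnegrE.
Qed.

Definition lp_off l x := lp_restr (fun k => k != l) x.

Lemma lp_norm_split l x : `|x| `^ p = `|x l| `^ p + `|lp_off l x| `^ p.
Proof.
have -> : `|x l| = `|lp_restr (fun k => k == l) x|.
  rewrite -(lp_norm_single l (x l)); apply: eq_lp_norm => k /=.
  by case: eqP => [->|].
exact: (lp_norm_restrC (fun k => k == l)).
Qed.

(** Strict monotonicity of the norm: once [k] is split off, the remainders are still ordered, so a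
    strict inequality at [k] survives. *)
Lemma lp_norm_rigid x y : (forall k, `|x k| <= `|y k|) -> `|y| <= `|x| ->
  forall k, `|x k| = `|y k|.
Proof.
move=> xy yx k; apply: le_anti; rewrite xy/= leNgt; apply/negP => xyk.
have : `|x| `^ p < `|y| `^ p.
  rewrite (lp_norm_split k x) (lp_norm_split k y) ltr_leD// ?gt0_ltr_powR ?nnegrE//.
  apply: ge0_ler_powR; rewrite ?nnegrE ?(ltW p0)//; apply: ler_lp_norm => i /=.
  by case: ifP.
by apply/negP; rewrite -leNgt ge0_ler_powR ?nnegrE ?(ltW p0).
Qed.

Lemma lp_tail x (e : R) : 0 < e -> exists n, `|lp_restr (fun k => n <= k)%N x| <= e.
Proof.
move=> e0; have xfin : (\sum_(0 <= k <oo) (`|x k| `^ p)%:E < +oo)%E.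
  by rewrite -lp_norm_powR ltry.
have ge0 k : true -> (0 <= (`|x k| `^ p)%:E)%E by rewrite lee_fin powR_ge0.
have ep0 : (0 < (e `^ p)%:E)%E by rewrite lte_fin powR_gt0.
have /= := nneseries_tail_cvg xfin ge0; rewrite /cvg_to/nbhs/= => cv.
have [n _ /(_ n (leqnn n))/= tn] := cv _ (open_ereal_lt' ep0).
exists n; rewrite leNgt; apply/negP => en.
have : e `^ p < `|lp_restr (fun k => n <= k)%N x| `^ p.
  by rewrite gt0_ltr_powR ?nnegrE// ltW.
apply/negP; rewrite -leNgt -lee_fin lp_norm_powR; apply: ltW; apply: le_lt_trans tn.
rewrite [X in (_ <= X)%E]eseries_cond/= [X in (_ <= X)%E]eseries_mkcond.
apply: lee_nneseries => k _.
  by rewrite lee_fin powR_ge0.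
by rewrite /=; case: ifP => //; rewrite normr0 powR0 ?gt_eqF.
Qed.

Lemma lp_restr_ltS n x :
  lp_restr (fun k => k < n.+1)%N x =
  lp_restr (fun k => k < n)%N x + lp_single n (x n).
Proof.
apply: lp_ext => k; rewrite lp_addE/= ltnS leq_eqVlt.
by case: eqVneq => [->|_]/=; rewrite ?ltnn ?add0r ?addr0.
Qed.

Lemma lp_restr_lt0 x : lp_restr (fun k => k < 0)%N x = 0.
Proof. exact: lp_ext. Qed.

Lemma lp_restr_tail n x :
  x = lp_restr (fun k => k < n)%N x + lp_restr (fun k => n <= k)%N x.
Proof.
by apply: lp_ext => k; rewrite lp_addE/=; case: ltnP; rewrite ?addr0 ?add0r.
Qed.

(** Additivity kills the finite heads of [x], and the tail is small in norm. This form serves both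
    for the rows and for the entries of one row. *)
Lemma lp_additive_eq0 (V : normedZmodType R) (phi : lp -> V) x :
  {morph phi : a b / a + b} -> (forall a, `|phi a| <= `|a|) ->
  (forall k, phi (lp_single k (x k)) = 0) -> phi x = 0.
Proof.
move=> phiD phile phi0.
have head n : phi (lp_restr (fun k => k < n)%N x) = 0.
  elim: n => [|n IH]; last by rewrite lp_restr_ltS phiD IH phi0 addr0.
  by apply/normr0_eq0/le_anti; rewrite normr_ge0 (le_trans (phile _))// lp_restr_lt0 normr0.
apply/normr0_eq0/le_anti; rewrite normr_ge0 andbT.
apply/ler_addgt0Pl => e e0; rewrite addr0.
have [n xn] := lp_tail x e e0.
rewrite (lp_restr_tail n x) phiD head add0r.
exact: le_trans xn.
Qed.

(** One tail of [x] bounds the tails of all [u n]; the heads are finite sums of null sequences. *)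
Lemma lp_dominated_cvg0 x (u : nat -> lp) :
  (forall n k, `|u n k| <= `|x k|) ->
  (forall k, `|u n k| @[n --> \oo] --> 0) -> `|u n| @[n --> \oo] --> 0.
Proof.
move=> ux u0; apply/cvgr0Pnorm_le => e e0.
have e20 : 0 < e / 2 by rewrite divr_gt0.
have [m xm] := lp_tail x _ e20.
have hd n : `|lp_restr (fun k => k < m)%N (u n)| <= \sum_(0 <= k < m) `|u n k|.
  elim: m {xm} => [|m IH]; first by rewrite lp_restr_lt0 normr0 big_geq.
  rewrite lp_restr_ltS big_nat_recr//= (le_trans (ler_normD _ _))//.
  by rewrite lerD// lp_norm_single.
have s0 : (\sum_(0 <= k < m) `|u n k|) @[n --> \oo] --> 0.
  elim: m {xm hd} => [|m IH].
    by under eq_fun do rewrite big_geq//; exact: cvg_cst.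
  under eq_fun do rewrite big_nat_recr//=.
  by have := cvgD IH (u0 m); rewrite addr0; apply.
move/cvgr0Pnorm_le/(_ _ e20) : s0; apply: filterS => n sn.
rewrite normr_id (lp_restr_tail m (u n)) (le_trans (ler_normD _ _))// (splitr e).
rewrite lerD//; first by rewrite (le_trans (hd n))// (le_trans (ler_norm _)).
apply: le_trans xm; apply: ler_lp_norm => k /=; case: ifP => // _; exact: ux.
Qed.

End lp_space.

(** * Second differences of powers of norms *)

Section second_difference.
Context {R : realType}.
Implicit Types (p q t : R).

Definition second_diff (E : normedModType R) p (y z : E) t :=
  powR_gap p `|y| `|y + t *: z| `|y - t *: z|.

Lemma powR_ge1D s v : 1 <= s -> 0 <= v -> 1 + s * (v - 1) <= v `^ s :> R.
Proof.
move=> s1; rewrite le_eqVlt => /predU1P[<-|v0].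
  by rewrite powR0; [lra|rewrite gt_eqF//; lra].
have vi : v * v^-1 = 1 by rewrite mulfV ?gt_eqF.
rewrite -mulr_powRB1 ?(ltW v0)//; last lra.
have -> : 1 + s * (v - 1) = v * (1 + (s - 1) * (1 - v^-1)).
  transitivity (v + (s - 1) * (v - v * v^-1)); last by ring.
  by rewrite vi; ring.
rewrite ler_pM2l//; apply: le_trans (powR_ge1Dln v (s - 1) v0).
by rewrite lerD2l ler_wpM2l ?subr_ge0// ln_ge1BV.
Qed.

(** Convexity: add the tangent bounds at [N] for [a] and [b]; their linear terms have a nonnegative
    sum. *)
Lemma powR_gap_ge0 p N a b : 1 <= p -> 0 <= N -> 0 <= a -> 0 <= b ->
  2 * N <= a + b -> 0 <= powR_gap p N a b.
Proof.
move=> p1; rewrite le_eqVlt => /predU1P[<-|N0] a0 b0 ab.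
  rewrite /powR_gap powR0 ?mulr0 ?subr0 ?addr_ge0 ?powR_ge0//.
  by rewrite gt_eqF//; lra.
rewrite /powR_gap.
have le c : 0 <= c -> N `^ p * (1 + p * (c / N - 1)) <= c `^ p.
  move=> c0; have cN : 0 <= c / N by rewrite divr_ge0// ltW.
  rewrite -{2}(divfK (lt0r_neq0 N0) c) (powRM p cN (ltW N0)) mulrC ler_wpM2r ?powR_ge0//.
  exact: powR_ge1D.
have := le _ a0; have := le _ b0.
have : 0 <= N `^ p * (p * ((a + b - 2 * N) / N)).
  rewrite mulr_ge0 ?powR_ge0// mulr_ge0//; first lra.
  by rewrite divr_ge0 ?(ltW N0)//; lra.
have -> : (a + b - 2 * N) / N = (a / N - 1) + (b / N - 1) by field; rewrite gt_eqF.
rewrite mulrDr !mulrDr; lra.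
Qed.

Lemma midpoint_norm (E : normedModType R) (y z : E) : 2 * `|y| <= `|y + z| + `|y - z|.
Proof.
apply: le_trans (ler_normD _ _); rewrite addrACA subrr addr0 -mulr2n.
by rewrite normrMn mulr_natl.
Qed.

Lemma second_diff_ge0 (E : normedModType R) p (y z : E) t :
  1 <= p -> 0 <= second_diff E p y z t.
Proof. by move=> p1; apply: powR_gap_ge0 => //; exact: midpoint_norm. Qed.

Lemma second_diff_0r (E : normedModType R) p (y : E) t : second_diff E p y 0 t = 0.
Proof. by rewrite /second_diff /powR_gap scaler0 addr0 subr0; lra. Qed.

Lemma second_diff_0l (E : normedModType R) p (z : E) t : 0 < p -> 0 <= t ->
  second_diff E p 0 z t = 2 * `|z| `^ p * t `^ p.
Proof.
move=> p0 t0; rewrite /second_diff /powR_gap add0r sub0r normrN normrZ ger0_norm// normr0.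
by rewrite powR0 ?gt_eqF// powRM//; ring.
Qed.

(** This links the outer exponent with the exponent inside a row where [y] does not vanish. *)
Lemma second_diff_comparable (E : normedModType R) p q (y z : E) :
  1 < p -> 1 < q -> y != 0 ->
  exists2 k, 0 < k & exists2 d, 0 < d & forall t, 0 < t <= d ->
    k * second_diff E q y z t <= second_diff E p y z t.
Proof.
move=> p1 q1 y0; have N0 : 0 < `|y| by rewrite normr_gt0.
have [k k0 [d d0 H]] := powR_gap_comparable p q _ p1 q1 N0.
(* This radius keeps the norms of [y + t z] and [y - t z] within [d] of that of [y]; adding 1 covers
   [z = 0]. *)
exists k => //; exists (d / (`|z| + 1)); first by rewrite divr_gt0// ltr_wpDl.
move=> t /andP[t0 td]; apply: H; last exact: midpoint_norm.
- apply: le_trans (ler_dist_dist _ _) _.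
  rewrite addrAC subrr add0r normrZ gtr0_norm//; move: td; rewrite ler_pdivlMr ?ltr_wpDl//.
  by apply: le_trans; rewrite ler_pM2l// lerDl.
- apply: le_trans (ler_dist_dist _ _) _.
  rewrite addrAC subrr add0r normrN normrZ gtr0_norm//; move: td; rewrite ler_pdivlMr ?ltr_wpDl//.
  by apply: le_trans; rewrite ler_pM2l// lerDl.
Qed.

(** Factor out [|y|^q]: the quadratic bounds apply at [1 + t h] and [1 - t h], and the linear terms
    cancel. *)
Lemma second_diff_real q (y z : R) : 1 < q -> y != 0 -> z != 0 ->
  exists2 c, 0 < c & exists C, exists2 d, 0 < d & forall t, 0 < t <= d ->
    c * t `^ 2 <= second_diff R q y z t <= C * t `^ 2.
Proof.
move=> q1 y0 z0; have q0 : 0 < q by lra.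
have y_gt0 : 0 < `|y| by rewrite normr_gt0.
pose h := z / y; have h0 : 0 < `|h| by rewrite normr_gt0 mulf_neq0// invr_neq0.
have hh0 : 0 < h ^+ 2 by rewrite -real_normK ?num_real// exprn_gt0.
pose c := `|y| `^ q * (2 * ((q - 1) ^+ 2 / 8 * h ^+ 2)).
exists c.
  rewrite mulr_gt0 ?powR_gt0// mulr_gt0// mulr_gt0// divr_gt0// exprn_gt0//; lra.
exists (`|y| `^ q * (2 * (2 * q ^+ 2 * h ^+ 2))).
exists ((2 * q)^-1 / `|h|); first by rewrite divr_gt0// invr_gt0 mulr_gt0.
move=> t /andP[t0 td].
have th : `|t * h| <= (2 * q)^-1 by rewrite normrM gtr0_norm// -ler_pdivlMr.
have q2 : (2 * q)^-1 <= 2^-1 by rewrite lef_pV2 ?posrE//; lra.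
have := th; rewrite ler_norml => /andP[thl thu].
have nE (s : R) : 0 <= 1 + s * h -> `|y + s *: z| = `|y| * (1 + s * h).
  move=> s0; rewrite -[in RHS](ger0_norm s0) -normrM; congr (`|_|).
  by rewrite /h /GRing.scale/=; field.
rewrite /second_diff /powR_gap -scaleNr !nE ?mulNr; [|lra..].
have v1 : 0 <= 1 + t * h by lra.
have v2 : 0 <= 1 - t * h by lra.
rewrite (powRM q (normr_ge0 y) v1) (powRM q (normr_ge0 y) v2).
have -> : `|y| `^ q * (1 + t * h) `^ q + `|y| `^ q * (1 - t * h) `^ q - 2 * `|y| `^ q =
  `|y| `^ q * ((1 + t * h) `^ q + (1 - t * h) `^ q - 2) by ring.
rewrite /c -!mulrA !ler_pM2l ?powR_gt0// powR_mulrn ?(ltW t0)//.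
have a1 : `|1 + t * h - 1| <= (2 * q)^-1 by rewrite addrC addKr.
have a2 : `|1 - t * h - 1| <= (2 * q)^-1 by rewrite addrC addKr normrN.
have := powR_ge_quad _ _ q1 a1; have := powR_ge_quad _ _ q1 a2.
have := powR_le_quad _ _ q1 a1; have := powR_le_quad _ _ q1 a2.
set A := _ `^ q; set B := _ `^ q.
have -> : (1 + t * h - 1) ^+ 2 = h ^+ 2 * t ^+ 2 by ring.
have -> : (1 - t * h - 1) ^+ 2 = h ^+ 2 * t ^+ 2 by ring.
rewrite !mulrA; set X := h ^+ 2 * t ^+ 2; move=> *; apply/andP; split; lra.
Qed.

Lemma second_diff_lp_split (E : normedModType R) p (p1 : 1 <= p) l (y z : lp E p1) t :
  second_diff _ p y z t =
  second_diff _ p (y l) (z l) t + second_diff _ p (lp_off l y) (lp_off l z) t.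
Proof.
rewrite /second_diff /powR_gap.
have offD (s : R) : lp_off l (y + s *: z) = lp_off l y + s *: lp_off l z.
  apply: lp_ext => k; rewrite lp_addE lp_scaleE/=.
  by case: ifP => _ //; rewrite scaler0 addr0.
rewrite -!(scaleNr t) -!offD (lp_norm_split l y) (lp_norm_split l (y + t *: z)).
rewrite (lp_norm_split l (y + - t *: z)).
have sum3 (a b c d e f : R) :
  a + b + (c + d) - 2 * (e + f) = a + c - 2 * e + (b + d - 2 * f) by ring.
exact: sum3.
Qed.

Lemma second_diff_lp_ge (E : normedModType R) p (p1 : 1 <= p) l (y z : lp E p1) t :
  second_diff _ p (y l) (z l) t <= second_diff _ p y z t.
Proof. by rewrite (second_diff_lp_split _ _ _ l) lerDl second_diff_ge0. Qed.

Lemma second_diff_lp_single (E : normedModType R) p (p1 : 1 <= p) l (y : lp E p1) v t :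
  second_diff _ p y (lp_single l v) t = second_diff _ p (y l) v t.
Proof.
rewrite (second_diff_lp_split _ _ _ l) lp_singleE.
have -> : lp_off l (lp_single l v) = 0 :> lp E p1.
  by apply: lp_ext => k /=; case: eqP.
by rewrite second_diff_0r addr0.
Qed.

End second_difference.

(** * Entries in [l_p(l_q)] and contractive projections *)

Section mixed_norm_space.
Context {R : realType} {p q : R} {p1 : 1 <= p} {q1 : 1 <= q}.
Local Notation Z := (lp (lp R q1) p1).
Implicit Types (x y z : Z) (a b : nat * nat) (A : pred (nat * nat)) (t : R).

Definition entry x a : R := x a.1 a.2.

Lemma entry_ext x y : (forall a, entry x a = entry y a) -> x = y.
Proof. by move=> xy; apply: lp_ext => k; apply: lp_ext => j; exact: (xy (k, j)). Qed.

Lemma entryD x y a : entry (x + y) a = entry x a + entry y a.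
Proof. by rewrite /entry !lp_addE. Qed.
Lemma entryN x a : entry (- x) a = - entry x a.
Proof. by rewrite /entry !lp_oppE. Qed.
Lemma entryZ (c : R) x a : entry (c *: x) a = c * entry x a.
Proof. by rewrite /entry !lp_scaleE. Qed.
Lemma entry0 a : entry (0 : Z) a = 0. Proof. by []. Qed.
Lemma entry_sum (I : Type) (r : seq I) (F : I -> Z) a :
  entry (\sum_(i <- r) F i) a = \sum_(i <- r) entry (F i) a.
Proof. by rewrite /entry !lp_sumE. Qed.

Lemma ler_entry x a : `|entry x a| <= `|x|.
Proof. exact: le_trans (ler_lp_coord _ _) (ler_lp_coord _ _). Qed.

Lemma ler_entry_norm x y : (forall a, `|entry x a| <= `|entry y a|) -> `|x| <= `|y|.
Proof.
by move=> xy; apply: ler_lp_norm => k; apply: ler_lp_norm => j; exact: (xy (k, j)).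
Qed.

Lemma entry_norm_rigid x y : (forall a, `|entry x a| <= `|entry y a|) ->
  `|y| <= `|x| -> forall a, `|entry x a| = `|entry y a|.
Proof.
move=> xy yx [k j].
have rows i : `|x i| <= `|y i| by apply: ler_lp_norm => l; exact: (xy (i, l)).
by apply: lp_norm_rigid => [l|]; [exact: (xy (k, l))|rewrite (lp_norm_rigid x y)].
Qed.

Lemma erestr_subproof A x :
  (fun k => lp_restr (fun j => A (k, j)) (x k)) \in lp_pred p.
Proof.
apply: (lp_dominated x) => k; apply: ler_lp_norm => j /=.
by case: ifP; rewrite ?normr0.
Qed.

Definition erestr A x : Z := Lp p1 (erestr_subproof A x).

Lemma entry_erestr A x a : entry (erestr A x) a = if A a then entry x a else 0.
Proof. by case: a. Qed.

Lemma ler_norm_erestr A x : `|erestr A x| <= `|x|.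
Proof. by apply: ler_entry_norm => a; rewrite entry_erestr; case: ifP; rewrite ?normr0. Qed.

Lemma erestr_cvg0 x (A : nat -> pred (nat * nat)) :
  (forall a, \forall n \near \oo, ~~ A n a) -> `|erestr (A n) x| @[n --> \oo] --> 0.
Proof.
move=> An; apply: (lp_dominated_cvg0 x) => [n k|k].
  by apply: ler_lp_norm => j /=; case: ifP; rewrite ?normr0.
apply: (lp_dominated_cvg0 (x k)) => [n j|j].
  by rewrite /=; case: ifP; rewrite ?normr0.
apply/cvgr0Pnorm_le => e e0; have := An (k, j); apply: filterS => n /= /negbTE ->.
by rewrite !normr0 ltW.
Qed.

Definition unit_elt a : Z := lp_single a.1 (lp_single a.2 (1 : R)).

Lemma entry_unit a b : entry (unit_elt a) b = (a == b)%:R.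
Proof.
case: a b => a1 a2 [b1 b2]; rewrite /entry /= xpair_eqE eq_sym.
by case: eqVneq => //= _; rewrite eq_sym; case: eqP.
Qed.

(* The exponent of the decay at [0] of the second difference of the [p]-th power of
   the norm at [y] in the direction of the unit vector at [a]. *)
Definition growth y a : R :=
  if y a.1 == 0 then p else if entry y a == 0 then q else 2.

Hypotheses (p_gt1 : 1 < p) (q_gt1 : 1 < q).
Let p0 : 0 < p. Proof. exact: lt_trans ltr01 p_gt1. Qed.
Let q0 : 0 < q. Proof. exact: lt_trans ltr01 q_gt1. Qed.

Lemma growth_gt1 y a : 1 < growth y a.
Proof. by rewrite /growth; do 2 case: ifP => //; rewrite ltr1n. Qed.

(** Keep only the row of [b], and in it only the entry at [b]. Where [y] vanishes this leaves an
    exact power of [t]; on a nonzero row the exponent [p] is first exchanged for [q]. *)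
Lemma second_diff_lower y z b : entry z b != 0 ->
  exists2 c, 0 < c & exists2 d, 0 < d & forall t, 0 < t <= d ->
    c * t `^ growth y b <= second_diff Z p y z t.
Proof.
case: b => k j; rewrite /growth /entry /= => zb.
have zk : z k != 0 by apply: contraNneq zb => ->.
have [yk|yk] := eqVneq (y k) 0.
  exists (2 * `|z k| `^ p); first by rewrite mulr_gt0 ?powR_gt0 ?normr_gt0.
  exists 1 => // t /andP[t0 _].
  by apply: le_trans (second_diff_lp_ge _ _ _ k _ _ _); rewrite yk second_diff_0l// ltW.
have [m m0 [d d0 H]] := second_diff_comparable _ _ _ _ (z k) p_gt1 q_gt1 yk.
have {}H t : 0 < t <= d -> m * second_diff R q (y k j) (z k j) t <= second_diff Z p y z t.
  move=> td; apply: le_trans (second_diff_lp_ge _ _ _ k _ _ _).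
  by apply: le_trans (H _ td); rewrite ler_pM2l// second_diff_lp_ge.
have [yj|yj] := eqVneq (y k j) 0.
  exists (m * (2 * `|z k j| `^ q)); first by rewrite !mulr_gt0 ?powR_gt0 ?normr_gt0.
  exists d => // t td; have /andP[t0 _] := td.
  by apply: le_trans (H _ td); rewrite yj second_diff_0l ?(ltW t0)// -(mulrA m).
have [c c0 [C [e e0 G]]] := second_diff_real _ _ _ q_gt1 yj zb.
exists (m * c); first exact: mulr_gt0.
exists (Num.min d e) => [|t]; first by rewrite lt_min d0.
rewrite le_min => /and3P[t0 td te].
have /G/andP[Gl _] : 0 < t <= e by rewrite t0.
apply: le_trans (H t _); last by rewrite t0.
by rewrite -mulrA ler_pM2l.
Qed.

(** A unit vector lives on one entry of one row, so passing to them loses nothing; the exponents are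
    now compared in the other direction. *)
Lemma second_diff_upper y a :
  exists C, exists2 d, 0 < d & forall t, 0 < t <= d ->
    second_diff Z p y (unit_elt a) t <= C * t `^ growth y a.
Proof.
case: a => k j; rewrite /growth /entry /=.
have [yk|yk] := eqVneq (y k) 0.
  exists 2; exists 1 => // t /andP[t0 _].
  by rewrite second_diff_lp_single yk second_diff_0l ?(ltW t0)// lp_norm_single normr1 powR1 mulr1.
have [m m0 [d d0 H]] := second_diff_comparable _ _ _ _ (lp_single j (1 : R)) q_gt1 p_gt1 yk.
have {}H t : 0 < t <= d -> second_diff Z p y (unit_elt (k, j)) t <=
    m^-1 * second_diff R q (y k j) 1 t.
  move=> td; rewrite second_diff_lp_single ler_pdivlMl//.
  by apply: le_trans (H _ td) _; rewrite second_diff_lp_single.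
have [yj|yj] := eqVneq (y k j) 0.
  exists (m^-1 * 2); exists d => // t td; have /andP[t0 _] := td.
  by apply: le_trans (H _ td) _; rewrite yj second_diff_0l ?(ltW t0)// normr1 powR1 mulr1 mulrA.
have [c c0 [C [e e0 G]]] := second_diff_real _ _ _ q_gt1 yj (oner_neq0 R).
exists (m^-1 * C); exists (Num.min d e) => [|t]; first by rewrite lt_min d0.
rewrite le_min => /and3P[t0 td te].
have /G/andP[_ Gu] : 0 < t <= e by rewrite t0.
apply: le_trans (H t _) _; first by rewrite t0.
by rewrite -mulrA ler_pM2l ?invr_gt0.
Qed.

(** * Contractive projections and the sets of entries they preserve *)

Section projection.
Context (P : {linear Z -> Z}).
Hypotheses (P_idem : forall x, P (P x) = P x) (P_le : forall x, `|P x| <= `|x|).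

(** The second difference along [P (unit_elt a)] lies between the lower bound attached to [b] and
    the upper bound attached to [a]. *)
Lemma growth_le y a b : P y = y -> entry (P (unit_elt a)) b != 0 ->
  growth y a <= growth y b.
Proof.
move=> Py zb; have [c c0 [d d0 L]] := second_diff_lower y _ _ zb.
have [C [e e0 U]] := second_diff_upper y a.
have de0 : 0 < Num.min d e by rewrite lt_min d0.
apply: (powR_exponent_le _ C _ _ _ c0 de0) => t; rewrite le_min => /and3P[t0 td te].
apply: (le_trans (L t _)); first by rewrite t0.
apply: le_trans (U t _); last by rewrite t0.
have Pc s : `|y + s *: P (unit_elt a)| <= `|y + s *: unit_elt a|.
  by rewrite -{1}Py -linearZ -linearD.
rewrite /second_diff /powR_gap -!(scaleNr t) lerD2r.
by apply: lerD; apply: ge0_ler_powR; rewrite ?nnegrE ?(ltW p0)//; exact: Pc.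
Qed.

(** Only unit vectors are tested, as these are what [growth_le] controls; [preserves_span] passes to
    all elements living on [A]. *)
Definition preserves A :=
  forall a b, A a -> ~~ A b -> entry (P (unit_elt a)) b = 0.

Lemma preserves_span A x : preserves A -> (forall a, ~~ A a -> entry x a = 0) ->
  forall b, ~~ A b -> entry (P x) b = 0.
Proof.
move=> PA xA b bA.
apply: (lp_additive_eq0 R (fun y => entry (P y) b)) => [y z|y|k].
- by rewrite linearD.
- exact: le_trans (ler_entry _ _) (P_le _).
apply: (lp_additive_eq0 R (fun v => entry (P (lp_single k v)) b)) => [u v|v|j].
- rewrite -entryD -linearD; congr (entry (P _) b).
  by apply: lp_ext => i; rewrite lp_addE /=; case: eqP => // _; rewrite addr0.
- by rewrite -(@lp_norm_single _ _ _ p1 k v); exact: le_trans (ler_entry _ _) (P_le _).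
have -> : lp_single k (lp_single j (x k j)) = entry x (k, j) *: unit_elt (k, j) :> Z.
  apply: entry_ext => c; rewrite entryZ entry_unit; case: c => c1 c2.
  rewrite /entry /= xpair_eqE (eq_sym k) (eq_sym j).
  by case: eqP => _ /=; [case: eqP => _|]; rewrite ?mulr1 ?mulr0.
rewrite linearZ entryZ; have [kjA|kjA] := boolP (A (k, j)).
  by rewrite PA// mulr0.
by rewrite xA// mul0r.
Qed.

(** Split [P (unit_elt a)] into [w] on [A] and [x'] off [A]. Strict monotonicity of the norm gives
    [P w = w], and smoothness at [w] then forces [w = 0]. *)
Lemma preservesC A : preserves A -> preserves (predC A).
Proof.
move=> PA a b /= aA; rewrite negbK => bA.
pose v := P (unit_elt a); pose w := erestr A v; pose x' := erestr (predC A) v.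
have vE : v = w + x'.
  apply: entry_ext => c; rewrite entryD !entry_erestr /=.
  by case: (A c); rewrite ?addr0 ?add0r.
have PwA c : ~~ A c -> entry (P w) c = 0.
  apply: preserves_span => // d dA; by rewrite entry_erestr (negbTE dA).
have Pv : P v = v by exact: P_idem.
have Px' : P x' = v - P w by rewrite -{1}Pv {1}vE linearD addrAC subrr add0r.
have x'E : x' = erestr (predC A) (P x').
  apply: entry_ext => c; rewrite !entry_erestr /= Px' entryD entryN.
  by case: (boolP (A c)) => //= cA; rewrite PwA// subr0.
(* Off [A], [P x'] agrees with [x'], so contractivity leaves no room for nonzero entries of [P x']
   on [A], where [P x'] is [w - P w]. *)
have Pw : P w = w.
  apply: entry_ext => c; have [cA|cA] := boolP (A c); last first.
    by rewrite PwA// entry_erestr (negbTE cA).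
  have le d : `|entry (erestr (predC A) (P x')) d| <= `|entry (P x') d|.
    by rewrite entry_erestr; case: ifP; rewrite ?normr0.
  have le' : `|P x'| <= `|erestr (predC A) (P x')| by rewrite -x'E.
  have := entry_norm_rigid _ _ le le' c.
  rewrite entry_erestr /= cA normr0 Px' entryD entryN => /esym/eqP.
  by rewrite normr_eq0 subr_eq0 => /eqP <-; rewrite entry_erestr cA.
suff w0 : w = 0 by rewrite -/v vE w0 add0r entry_erestr /= bA.
apply/eqP; apply/negPn/negP => w_neq0.
have := growth_gt1 w a; apply/negP; rewrite -leNgt.
have [C [d d0 U]] := second_diff_upper w a.
have wp : 0 < `|w| `^ p by rewrite powR_gt0 ?normr_gt0.
apply: (powR_exponent_le (`|w| `^ p) C d 1) => // t td.
have /andP[t0 _] := td; apply: le_trans (U _ td).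
(* [P] sends [w + t e_a] to [w + t v], whose part on [A] is [(1 + t) w]. With [dn], the second
   difference at [w] is thus at least linear in [t], against the order [growth w a > 1]. *)
have up : (1 + t) * `|w| `^ p <= `|w + t *: unit_elt a| `^ p.
  apply: (@le_trans _ _ (((1 + t) * `|w|) `^ p)).
    rewrite powRM ?addr_ge0 ?(ltW t0)// ler_pM2r//.
    by apply: le1r_powR => //; rewrite lerDl ltW.
  have -> : (1 + t) * `|w| = `|(1 + t) *: w| by rewrite normrZ ger0_norm// addr_ge0// ltW.
  apply: ge0_ler_powR; rewrite ?nnegrE ?(ltW p0)//.
  have -> : (1 + t) *: w = erestr A (P (w + t *: unit_elt a)).
    rewrite linearD linearZ Pw; apply: entry_ext => c.
    rewrite entry_erestr entryD !entryZ entry_erestr; case: ifP => _; rewrite ?mulr0//.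
    by rewrite mulrDl mul1r.
  exact: le_trans (ler_norm_erestr _ _) (P_le _).
have dn : `|w| `^ p <= `|w - t *: unit_elt a| `^ p.
  apply: ge0_ler_powR; rewrite ?nnegrE ?(ltW p0)//.
  have {1}-> : w = erestr A (w - t *: unit_elt a).
    apply: entry_ext => c; rewrite !entry_erestr entryD entryN entryZ entry_unit entry_erestr.
    case: ifP => // cA; case: eqP => [ac|_]; last by rewrite mulr0 subr0.
    by move: aA; rewrite ac cA.
  exact: ler_norm_erestr.
rewrite powRr1 ?(ltW t0)// /second_diff /powR_gap; move: up dn; lra.
Qed.

End projection.
End mixed_norm_space.

(** * The block basis *)

Section contractive_projections.
Context {R : realType} {p q : R} {p1 : 1 <= p} {q1 : 1 <= q}.
Local Notation Z := (lp (lp R q1) p1).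
Implicit Types (x y z : Z) (a b c : nat * nat) (A : pred (nat * nat)).
Hypothesis (hpq : (1 < p < 2 /\ 2 < q) \/ (2 < p /\ 1 < q < 2)).
Context (P : {linear Z -> Z}).
Hypotheses (P_idem : forall x, P (P x) = P x) (P_le : forall x, `|P x| <= `|x|).

Let p_gt1 : 1 < p. Proof. by case: hpq => [[/andP[]]|[p2 _]] //; lra. Qed.
Let q_gt1 : 1 < q. Proof. by case: hpq => [[_ q2]|[_ /andP[]]] //; lra. Qed.

Lemma entry_row_neq0 y a : entry y a != 0 -> y a.1 != 0.
Proof. by apply: contraNneq; rewrite /entry => ->. Qed.

(* On the rows where [y] vanishes, on its support, and on the remaining entries the
   exponent [growth y] is [p], [2] and [q], in this order either increasing or
   decreasing; this is where [p] and [q] have to lie on opposite sides of [2]. *)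
Lemma preserves_off_support y : P y = y -> preserves P (fun a => entry y a == 0).
Proof.
move=> Py; have grow a b := growth_le p_gt1 q_gt1 P P_le y a b Py.
have invC := preservesC p_gt1 q_gt1 P P_idem P_le.
case: hpq => [[/andP[_ p2] q2]|[p2 /andP[_ q2]]].
(* Here [p < 2 < q]. Nonzero rows cannot lead to the lower order [p], so they are preserved, and by
   complement so are the zero rows. Zero entries of nonzero rows have the top order [q] and cannot
   lead to the support. *)
- have rows : preserves P (fun a => y a.1 == 0).
    suff /invC H : preserves P (fun a => y a.1 != 0).
      by move=> a b aA bA; apply: H => //=; rewrite negbK.
    move=> a b aA; rewrite negbK => bA; apply/eqP/negPn/negP => /grow.
    rewrite /growth bA (negbTE aA); case: ifP => _; rewrite leNgt; apply/negP;
      rewrite negbK; lra.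
  move=> a b ya yb; have [ya1|ya1] := boolP (y a.1 == 0).
    by apply: rows => //; exact: entry_row_neq0.
  apply/eqP/negPn/negP => /grow.
  by rewrite /growth (negbTE ya1) ya (negbTE yb) (negbTE (entry_row_neq0 _ _ yb)) leNgt q2.
(* Here [q < 2 < p]. The zero rows have the top order, so they and their complement are preserved.
   The support, of order 2, cannot lead to order [q]: it is preserved, and its complement with
   it. *)
- have rows : preserves P (fun a => y a.1 == 0).
    move=> a b aA bA; apply/eqP/negPn/negP => /grow.
    rewrite /growth aA (negbTE bA); case: ifP => _; rewrite leNgt; apply/negP;
      rewrite negbK; lra.
  suff /invC H : preserves P (fun a => entry y a != 0).
    by move=> a b ya yb; apply: H => //=; rewrite negbK.
  move=> a b ya; rewrite negbK => yb; have [yb1|yb1] := boolP (y b.1 == 0).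
    by apply: (invC _ rows) => /=; rewrite ?negbK//; exact: entry_row_neq0.
  apply/eqP/negPn/negP => /grow.
  by rewrite /growth (negbTE yb1) yb (negbTE ya) (negbTE (entry_row_neq0 _ _ ya)) leNgt q2.
Qed.

(** * Images of the unit vectors *)

Let v a : Z := P (unit_elt a).

(** If [v a] vanishes at [a], [preserves_off_support] with [y = v a] makes it vanish on its own
    support. *)
Lemma proj_unit_neq0 a b : entry (v a) b != 0 -> entry (v a) a != 0.
Proof.
move=> vb; apply: contraNN (vb) => va; apply/eqP.
exact: (preserves_off_support (v a) (P_idem _)).
Qed.

(** Otherwise [v b = 0], and deleting the entry of [y] at [b] leaves an element of smaller norm that
    [P] still sends to [y]. *)
Lemma entry_proj_unit_neq0 y b : P y = y -> entry y b != 0 -> entry (v b) b != 0.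
Proof.
move=> Py yb; apply/negP => vb.
have vb0 : v b = 0.
  apply: entry_ext => c; rewrite entry0; apply/eqP; apply: contraTT vb.
  exact: proj_unit_neq0.
pose x := y - entry y b *: unit_elt b.
have xE c : entry x c = if b == c then 0 else entry y c.
  rewrite entryD entryN entryZ entry_unit; case: eqP => [->|_]; first by rewrite mulr1 subrr.
  by rewrite mulr0 subr0.
have Px : P x = y by rewrite linearB linearZ/= -/(v b) vb0 scaler0 subr0.
have le c : `|entry x c| <= `|entry y c| by rewrite xE; case: ifP; rewrite ?normr0.
have := entry_norm_rigid _ _ le; rewrite -{1}Px => /(_ (P_le _) b).
by rewrite xE eqxx normr0 => /esym/normr0P; rewrite (negbTE yb).
Qed.

(** Chosen so that [y - coef y a *: v a] vanishes at [a] whenever [v a] does not. *)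
Definition coef y a := entry y a / entry (v a) a.

(** The fixed element [y - coef y a *: v a] vanishes at [a], so by [preserves_off_support] it
    vanishes wherever [v a] does not. *)
Lemma entry_proj_unit y a b : P y = y -> entry (v a) b != 0 ->
  entry y b = coef y a * entry (v a) b.
Proof.
move=> Py vb; have va := proj_unit_neq0 _ _ vb.
pose x := y - coef y a *: v a.
have Px : P x = x by rewrite linearB linearZ/= Py /v P_idem.
have xa : entry x a == 0.
  by rewrite entryD entryN entryZ /coef divfK// subrr.
apply/eqP; rewrite -subr_eq0 -entryZ -entryN -entryD -/x.
apply: contraNT vb => xb; apply/eqP.
exact: (preserves_off_support x Px).
Qed.

(** On the support of [v a], [v b] is a multiple of [v a], nonzero because of [c]. Used both ways,
    this makes overlapping supports equal. *)
Lemma proj_unit_support a b c d : entry (v a) c != 0 -> entry (v b) c != 0 ->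
  entry (v a) d != 0 -> entry (v b) d != 0.
Proof.
move=> ac bc ad; have Pvb : P (v b) = v b by exact: P_idem.
rewrite (entry_proj_unit _ _ _ Pvb ad) mulf_neq0//.
by apply: contraNneq bc; rewrite (entry_proj_unit _ _ _ Pvb ac) => ->; rewrite mul0r.
Qed.

(** Overlapping supports coincide, so each is represented by its entry of least code; the condition
    at [a] discards zero vectors. *)
Definition block_index : set (nat * nat) :=
  [set a | entry (v a) a != 0 /\
           forall b, entry (v a) b != 0 -> (pickle a <= pickle b)%N].

Lemma block_index_disjoint a b c : block_index a -> block_index b -> a != b ->
  entry (v a) c != 0 -> entry (v b) c = 0.
Proof.
move=> [aa amin] [bb bmin] ab ac; apply/eqP; apply: contraNT ab => bc.
apply/eqP/(pcan_inj pickleK)/anti_leq/andP; split.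
- by apply: amin; exact: proj_unit_support bc ac bb.
- by apply: bmin; exact: proj_unit_support ac bc aa.
Qed.

Lemma block_index_cover y b : P y = y -> entry y b != 0 ->
  exists2 a, block_index a & entry (v a) b != 0.
Proof.
move=> Py yb; have vb := entry_proj_unit_neq0 _ _ Py yb.
(* The least code in the support of [v b] is sought; numbers coding no pair are excluded. *)
pose Q n := if @pickle_inv _ n is Some c then entry (v b) c != 0 else false.
have exQ : exists n, Q n by exists (pickle b); rewrite /Q pickleK_inv.
have [n Qn nmin] := ex_minnP exQ; move: Qn; rewrite {1}/Q.
case E : (pickle_inv n) => [a|//] vba.
have va := entry_proj_unit_neq0 _ _ (P_idem _) vba.
exists a; last exact: proj_unit_support vba va vb.
split=> // c ac; have bc : entry (v b) c != 0 by exact: proj_unit_support va vba ac.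
have pn : pickle a = n.
  by have := @pickle_invK (nat * nat)%type n; rewrite E.
rewrite pn; apply: nmin; by rewrite /Q pickleK_inv.
Qed.

(** On each of the disjoint supports the coefficients reproduce [y], so partial expansions are
    restrictions of [y]. *)
Lemma sum_coef y (s : seq (nat * nat)) : P y = y -> uniq s ->
  (forall a, a \in s -> block_index a) ->
  \sum_(a <- s) coef y a *: v a = erestr (fun b => has (fun a => entry (v a) b != 0) s) y.
Proof.
move=> Py; elim: s => [|a s IH] /=.
  by move=> _ _; rewrite big_nil; apply: entry_ext => b; rewrite entry_erestr entry0.
move=> /andP[as_ us] sT; rewrite big_cons IH//; last first.
  by move=> b bs; apply: sT; rewrite inE bs orbT.
apply: entry_ext => b; rewrite entryD entryZ !entry_erestr.
have [ab|ab] := eqVneq (entry (v a) b) 0; first by rewrite ab mulr0 add0r.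
rewrite -entry_proj_unit// ifF ?addr0//; apply/hasP => -[c cs].
apply/negP; rewrite negbK; apply/eqP; apply: (block_index_disjoint a c) => //.
- by apply: sT; rewrite mem_head.
- by apply: sT; rewrite inE cs orbT.
- by apply: contraNneq as_ => ->.
Qed.

(** The remainder is [y] restricted to the entries not yet covered; each entry of its support is
    covered at a finite stage, so dominated convergence applies. *)
Lemma cvg_sum_coef y (f : nat -> nat * nat) : P y = y -> set_bij [set: nat] block_index f ->
  series (fun i => coef y (f i) *: v (f i)) @ \oo --> y.
Proof.
move=> Py [fT finj fsurj].
pose S n := [seq f i | i <- iota 0 n].
have serE n : series (fun i => coef y (f i) *: v (f i)) n =
    erestr (fun b => has (fun a => entry (v a) b != 0) (S n)) y.
  rewrite -sum_coef//.
  - by rewrite big_map /series /= /index_iota subn0.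
  - by rewrite map_inj_uniq ?iota_uniq// => i j; apply: finj; rewrite inE.
  - by move=> a /mapP[i _ ->]; exact: fT.
pose A n b := (entry y b != 0) && ~~ has (fun a => entry (v a) b != 0) (S n).
have /cvgr0Pnorm_le H : `|erestr (A n) y| @[n --> \oo] --> 0.
  apply: erestr_cvg0 => b; have [yb|yb] := eqVneq (entry y b) 0.
    by apply: nearW => n; rewrite /A yb eqxx.
  have [a /fsurj[m _ <-] vb] := block_index_cover _ _ Py yb.
  exists m.+1 => // n /= mn; rewrite /A negb_and !negbK; apply/orP; right.
  by apply/hasP; exists (f m) => //; apply: map_f; rewrite mem_iota.
apply/cvgrPdist_le => e e0; apply: filterS (H e e0) => n; rewrite normr_id.
congr (`|_| <= e); rewrite serE; apply: entry_ext => b.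
rewrite entryD entryN !entry_erestr /A; case: has; rewrite ?andbF ?subrr//= andbT subr0.
by case: eqVneq.
Qed.

Lemma entry_cvg (u : nat -> Z) y b : u @ \oo --> y -> entry (u n) b @[n --> \oo] --> entry y b.
Proof.
move/cvgrPdist_le => uy; apply/cvgrPdist_le => e e0; apply: filterS (uy e e0) => n.
by apply: le_trans; rewrite -entryN -entryD ler_entry.
Qed.

(** Read the entry at [f i]: no other block is nonzero there, so partial sums are constant there
    from [i + 1] terms on. *)
Lemma coef_unique y (f : nat -> nat * nat) (r : nat -> R) :
  set_bij [set: nat] block_index f -> series (fun i => r i *: v (f i)) @ \oo --> y ->
  r = (fun i => coef y (f i)).
Proof.
move=> [fT finj fsurj] sy; apply/funext => i.
have [vi _] := fT i I; rewrite /coef; apply: (canRL (mulfK vi)).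
have := entry_cvg _ _ (f i) sy; move/cvg_lim => <- //; apply/esym/lim_near_cst => //.
exists i.+1 => // n /= ni; rewrite /series /= entry_sum (bigD1_seq i) ?mem_index_iota ?iota_uniq//=.
rewrite entryZ big1 ?addr0// => j ji; rewrite entryZ (block_index_disjoint (f i)) ?mulr0//.
- exact: fT.
- exact: fT.
- by apply: contraNneq ji => /finj ->//; rewrite inE.
Qed.

Lemma block_index_disjoint_elts a b : block_index a -> block_index b -> a != b ->
  disjoint_elts (v a) (v b).
Proof.
move=> aT bT ab k; apply/seteqP; split => // j [/= aj]; apply/negP; rewrite negbK.
by apply/eqP; exact: (block_index_disjoint a b (k, j)).
Qed.

Lemma range_fixed y : range P y -> P y = y.
Proof. by case=> x _ <-; exact: P_idem. Qed.

Lemma has_block_basis_range : has_block_basis (range P).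
Proof.
have rv a : range P (v a) by exists (unit_elt a).
have [/finite_seqP[s sE]|infT] := pselect (finite_set block_index).
- left; pose s' := undup s.
  have s'T a : a \in s' -> block_index a by rewrite mem_undup sE.
  exists (size s'), (fun i => v (tnth (in_tuple s') i)); split; last first.
    move=> i j ij; apply: block_index_disjoint_elts; try by apply: s'T; exact: mem_tnth.
    by rewrite (tnth_nth (0, 0)%N) (tnth_nth (0, 0)%N) nth_uniq ?undup_uniq.
  split=> // y /range_fixed Py.
  exists (fun i => coef y (tnth (in_tuple s') i)); split.
    rewrite -(big_tnth _ _ s' xpredT (fun a => coef y a *: v a)) sum_coef ?undup_uniq//.
    apply: entry_ext => b; rewrite entry_erestr; case: ifPn => // /hasPn nb.
    apply/eqP/negPn/negP => yb; have [a aT vb] := block_index_cover _ _ Py yb.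
    by have := nb a; rewrite mem_undup vb => /(_ _)/negP; apply; move: aT; rewrite sE.
  move=> r yr; apply/funext => i; set a := tnth _ i.
  have [va _] : block_index a by apply: s'T; exact: mem_tnth.
  rewrite /coef; apply/esym/(canRL (mulfK va)).
  rewrite yr entry_sum (bigD1 i)//= entryZ big1 ?addr0// => j ji.
  rewrite entryZ (block_index_disjoint a) ?mulr0//; try by apply: s'T; exact: mem_tnth.
  by rewrite /a !(tnth_nth (0, 0)%N) nth_uniq ?undup_uniq// eq_sym.
(* An infinite set of pairs is countable, so the natural numbers enumerate it without repetition. *)
- right; have /card_esym/card_set_bijP[f fbij] : (block_index #= [set: nat])%card.
    by apply/card_eqPle; split; [exact: countableP|exact/infiniteP].
  have [fT finj _] := fbij.
  exists (fun i => v (f i)); split; last first.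
    move=> i j ij; apply: block_index_disjoint_elts; try exact: fT.
    by apply: contraNneq ij => /finj ->//; rewrite inE.
  split=> // y /range_fixed Py; exists (fun i => coef y (f i)); split.
    exact: cvg_sum_coef.
  by move=> r /(coef_unique _ _ _ fbij).
Qed.

End contractive_projections.

Lemma contractive_projection_le (R : realType) (Z : normedModType R) (P : {linear Z -> Z}) :
  contractive_projection P -> forall x, `|P x| <= `|x|.
Proof.
move=> [_ P1] x; have [->|x0] := eqVneq x 0; first by rewrite linear0.
have nx : 0 < `|x| by rewrite normr_gt0.
have : (`|P (`|x|^-1 *: x)|%:E <= 1)%E.
  apply: le_trans P1; apply: ereal_sup_ubound; exists (`|x|^-1 *: x) => //=.
  by rewrite normrZ gtr0_norm ?invr_gt0// mulVf// gt_eqF.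
rewrite lee_fin linearZ/= normrZ gtr0_norm ?invr_gt0//.
by rewrite ler_pdivrMl// mulr1.
Qed.

Theorem corollary4p12 (R : realType) (p q : R) (p1 : 1 <= p) (q1 : 1 <= q)
    (hpq : (1 < p < 2 /\ 2 < q) \/ (2 < p /\ 1 < q < 2))
    (P : {linear lp (lp R q1) p1 -> lp (lp R q1) p1}) :
  contractive_projection P -> has_block_basis (range P).
Proof.
move=> Pc; apply: has_block_basis_range => //; first by case: Pc.
exact: contractive_projection_le.
Qed.
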